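(* Let $f$ be a monic univariate polynomial of degree $n$ with real coefficients, all of whose complex roots have nonnegative real part and which has at least one root with positive real part. Write $f(x)=\sum_{i=0}^n (-1)^i a_{n-i}x^{n-i}$ with $a_n=1$ and let $f=p-q$ where $$p(x)=\sum_{0\le 2i\le n} a_{n-2i}\,x^{n-2i},\qquad q(x)=\sum_{1\le 2i+1\le n} a_{n-(2i+1)}\,x^{n-(2i+1)}.$$ Let $x_0>0$ be a real number that is not a root of $f$, and define, for $t=0,1,2,\dots$, $$x_{t+1}=x_t\,\frac{p(x_t)}{q(x_t)},\qquad x_{-(t+1)}=x_{-t}\,\frac{q(x_{-t})}{p(x_{-t})}.$$ Let $(y_t)_{t\ge 0}$ be either of the two sequences $(x_t)_{t\ge0}$, $(x_{-t})_{t\ge0}$. If $(y_t)$ converges to a real number $\alpha$ which is a simple root of $f$, then the convergence is asymptotically linear: there exist $\rho\in[0,1)$ and $T\in\mathbb{N}$ such that $$|y_{t+1}-\alpha|\le\rho\,|y_t-\alpha|\quad\text{for all } t\ge T.$$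
   Context: Under the hypotheses on the roots of $f$, all coefficients $a_i$ are nonnegative, so $p$ and $q$ have nonnegative coefficients, all real roots of $f$ are nonnegative, and $p(x)>0$, $q(x)>0$ for all $x>0$, so the iterations are well defined and stay positive. (In this setting each of the two sequences converges either to one of the two consecutive real roots of $f$ enclosing $x_0$, or to $0$ if there is no real root below $x_0$, or to $+\infty$ if there is no real root above $x_0$.) A root $\alpha$ is simple if $f(\alpha)=0$ and $f'(\alpha)\neq0$. *)

(* Defs.v *)
From HB Require Import structures.
From mathcomp Require Import all_boot all_order all_algebra.
From mathcomp Require Import complex.
From mathcomp Require Import reals topology normedtype sequences.

Set Implicit Arguments.
Unset Strict Implicit.
Unset Printing Implicit Defensive.

Import Order.TTheory GRing.Theory Num.Theory.
Import numFieldNormedType.Exports.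

Local Open Scope ring_scope.

(* [a k] is the coefficient, up to sign, of the monomial ['X^k]; the sign
   attached to it in [alt_poly] is [(-1) ^+ (n - k)]. *)
Definition alt_poly (R : realType) (n : nat) (a : nat -> R) : {poly R} :=
  \sum_(i < n.+1) ((-1) ^+ i * a (n - i)%N) *: 'X^(n - i).

Definition alt_pos (R : realType) (n : nat) (a : nat -> R) : {poly R} :=
  \sum_(i < n.+1 | (2 * i <= n)%N) a (n - 2 * i)%N *: 'X^(n - 2 * i).

Definition alt_neg (R : realType) (n : nat) (a : nat -> R) : {poly R} :=
  \sum_(i < n.+1 | ((2 * i).+1 <= n)%N)
     a (n - (2 * i).+1)%N *: 'X^(n - (2 * i).+1).

(* [mult_iter p q x0 t] is x_t and [mult_iter q p x0 t] is x_{-t}. *)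
Fixpoint mult_iter (R : realType) (p q : {poly R}) (x0 : R) (t : nat) : R :=
  if t is t'.+1 then
    let x := mult_iter p q x0 t' in x * (p.[x] / q.[x])
  else x0.

Definition croot (R : realType) (f : {poly R}) (z : R[i]) : bool :=
  root (map_poly (real_complex R) f) z.

Definition simple_root (R : realType) (f : {poly R}) (alpha : R) : Prop :=
  f.[alpha] = 0 /\ f^`().[alpha] <> 0.

(* Main.v *)
Require Import Defs.
From HB Require Import structures.
From mathcomp Require Import all_boot all_order all_algebra.
From mathcomp Require Import complex.
From mathcomp Require Import boolp reals topology normedtype sequences derive.
From mathcomp Require Import ring lra.

Set Implicit Arguments.
Unset Strict Implicit.
Unset Printing Implicit Defensive.

Import Order.TTheory GRing.Theory Num.Theory.
Import numFieldNormedType.Exports.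

Local Open Scope classical_set_scope.
Local Open Scope ring_scope.

(** Write [u / v] for the quotient driving the iteration: [p / q] or [q / p].
    The limit [alpha] is a root of [f], hence [0 <= alpha], and one studies
    the map [G x = x * u(x) / v(x)], whose difference with the identity is
    [+- x * f(x) / v(x)].

    For [0 < alpha], write [f = k * ('X - alpha)] with [k(alpha) <> 0].  The
    multiplier of [G] at [alpha] is [1 + D], where
    [D = +- alpha * k(alpha) / v(alpha)] is nonzero.  The parities of [u] and
    [v] are opposite, so [f(-alpha) = +- (u + v)(alpha) = +- 2 v(alpha)], while
    [f(-alpha) = -2 alpha * k(-alpha)]; therefore
    [|D| = |k(alpha)| / |k(-alpha)|].  The roots of [k] lie in the closed right
    half-plane, so each of them is at least as close to [alpha] as to [-alpha],
    which gives [|D| <= 1] ([ler_norm_horner_reflect]).  Hence the multiplier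
    belongs to [0, 2] and differs from 1.  If it is less than 1 the iteration
    contracts distances to [alpha] by a fixed factor
    ([attracting_linear_convergence]).  If it is greater than 1, then [alpha]
    repels every point other than itself, and a sequence that still converges
    to [alpha] must reach it in finitely many steps
    ([repelling_linear_convergence]).

    For [alpha = 0], the even one among [u] and [v] vanishes to order at least
    2 at 0, and the odd one to order exactly 1 because the root is simple.  So
    [u / v] tends either to 0, and convergence is superlinear, or to infinity,
    and 0 is repelling. *)

(** * Polynomials with roots in the right half-plane *)

(** For [0 < c], the half-plane [0 <= Re z] is the set of points at least as
    close to [c] as to [-c]. *)
Lemma ler_norm_reflect (R : realType) (c : R) (z : R[i]) :
  0 <= c -> 0 <= complex.Re z -> `|c%:C - z|%C <= `|(- c)%:C - z|%C.
Proof.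
case: z => x y /= c0 x0; rewrite !normc_def /= lecR ler_wsqrtr //.
rewrite lerD2r -subr_ge0.
have -> : (- c - x) ^+ 2 - (c - x) ^+ 2 = 4%:R * (c * x) by ring.
by rewrite mulr_ge0 // mulr_ge0.
Qed.

(** Factor [k] over the complex numbers and compare factor by factor. *)
Lemma ler_norm_horner_reflect (R : realType) (k : {poly R}) (c : R) :
  (forall z : R[i], croot k z -> 0 <= complex.Re z) -> 0 <= c ->
  `|k.[c]| <= `|k.[- c]|.
Proof.
move=> kroots c0.
have normC x : (`|x|)%:C%C = `|x%:C%C| :> R[i].
  by rewrite normc_def /= expr0n addr0 sqrtr_sqr.
rewrite -lecR !normC.
have hornerC x : (k.[x])%:C%C = (map_poly (real_complex R) k).[x%:C%C].
  by rewrite horner_map.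
rewrite !hornerC.
have [rs krs] := closed_field_poly_normal (map_poly (real_complex R) k).
have rsP z : z \in rs -> 0 <= complex.Re z.
  move=> zrs; apply: kroots; rewrite /croot krs.
  have [->|l0] := eqVneq (lead_coef (map_poly (real_complex R) k)) 0.
    by rewrite scale0r root0.
  by rewrite rootZ // root_prod_XsubC.
rewrite krs !hornerZ !normrM ler_wpM2l //.
rewrite !horner_prod !normr_prod big_seq [leRHS]big_seq.
apply: ler_prod => z zrs; rewrite normr_ge0 !hornerXsubC.
exact: ler_norm_reflect (rsP z zrs).
Qed.

(** * Even and odd parts of the alternating polynomial *)

Lemma big_ord_even_odd (V : nmodType) (n : nat) (F : nat -> V) :
  \sum_(i < n.+1) F i =
  \sum_(i < n.+1 | (2 * i <= n)%N) F (2 * i)%N +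
  \sum_(i < n.+1 | ((2 * i).+1 <= n)%N) F (2 * i).+1.
Proof.
(* Extending [F] by zero gives a range of even length, cut into pairs
   [(2i, 2i+1)]. *)
pose F0 i := if (i <= n)%N then F i else 0.
have pair m : \sum_(i < 2 * m) F0 i =
    \sum_(i < m) (F0 (2 * i)%N + F0 (2 * i).+1).
  elim: m => [|m IHm]; first by rewrite muln0 !big_ord0.
  by rewrite mulnS !addSn add0n !big_ord_recr /= IHm addrA.
rewrite [X in X + _]big_mkcond [X in _ + X]big_mkcond -big_split /=.
rewrite -[RHS](pair n.+1) -(big_mkord xpredT F) -(big_mkord xpredT F0).
rewrite (@big_cat_nat _ _ _ n.+1 0%N (2 * n.+1)) //=; last by rewrite leq_pmull.
rewrite [X in _ + X]big_nat_cond [X in _ + X]big1 ?addr0.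
  by apply: eq_big_nat => i /andP[_ ltin]; rewrite /F0 -ltnS ltin.
by move=> i; rewrite andbT => /andP[ltni _]; rewrite /F0 leqNgt ltni.
Qed.

Lemma alt_polyE (R : realType) (n : nat) (a : nat -> R) :
  alt_poly n a = alt_pos n a - alt_neg n a.
Proof.
rewrite /alt_poly.
rewrite (@big_ord_even_odd _ n (fun i => ((-1) ^+ i * a (n - i)%N) *: 'X^(n - i))).
rewrite -sumrN; congr (_ + _); apply: eq_bigr => i _.
  by rewrite exprM sqrrN !expr1n mul1r.
by rewrite exprS exprM sqrrN !expr1n mulr1 mulN1r scaleNr.
Qed.

Lemma alt_pos_comp_oppX (R : realType) (n : nat) (a : nat -> R) :
  alt_pos n a \Po (- 'X) = (-1) ^+ n *: alt_pos n a.
Proof.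
rewrite /alt_pos linear_sum scaler_sumr; apply: eq_bigr => i le2in /=.
rewrite linearZ /= comp_Xn_poly (exprNn 'X).
have -> : (-1) ^+ (n - 2 * i) = (-1) ^+ n :> {poly R}.
  by rewrite -signr_odd oddB // oddM /= addbF signr_odd.
by rewrite -2!(signr_odd _ n) mulr_sign scaler_sign; case: odd;
  rewrite ?scalerN.
Qed.

Lemma alt_neg_comp_oppX (R : realType) (n : nat) (a : nat -> R) :
  alt_neg n a \Po (- 'X) = - (-1) ^+ n *: alt_neg n a.
Proof.
rewrite /alt_neg linear_sum scaler_sumr; apply: eq_bigr => i le2in /=.
rewrite linearZ /= comp_Xn_poly (exprNn 'X).
have -> : (-1) ^+ (n - (2 * i).+1) = - (-1) ^+ n :> {poly R}.
  by rewrite -signr_odd oddB //= oddM /= addbT signrN signr_odd.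
by rewrite mulNr scaleNr -2!(signr_odd _ n) mulr_sign scaler_sign; case: odd;
  rewrite ?scalerN.
Qed.

(** * Attracting and repelling fixed points *)

Definition linear_convergence (R : realType) (y : nat -> R) (alpha : R) : Prop :=
  exists (rho : R) (T : nat), 0 <= rho < 1 /\
    forall t : nat, (T <= t)%N ->
      `|y t.+1 - alpha| <= rho * `|y t - alpha|.

(** The value [m alpha] is the multiplier of [G] at its fixed point; by
    continuity a factor between its modulus and 1 bounds [m] nearby. *)
Lemma attracting_linear_convergence (R : realType) (y : nat -> R) (G m : R -> R)
    (alpha : R) :
  (forall t, y t.+1 = G (y t)) -> y @ \oo --> alpha ->
  (\forall x \near alpha, G x - alpha = m x * (x - alpha)) ->
  m x @[x --> alpha] --> m alpha -> `|m alpha| < 1 ->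
  linear_convergence y alpha.
Proof.
move=> yS ycvg Gm mcvg m1.
pose rho := (`|m alpha| + 1) / 2%:R.
have mrho : `|m alpha| < rho by rewrite /rho; lra.
have /ycvg[T _ yT] : \forall x \near alpha,
    G x - alpha = m x * (x - alpha) /\ `|m x| < rho.
  by apply: filterI Gm _; exact: cvgr_norm_lt mcvg _ mrho.
exists rho, T; split=> [|t Tt].
  by have := normr_ge0 (m alpha); rewrite /rho; lra.
have [Gy my] := yT t Tt.
by rewrite yS Gy normrM ler_wpM2r // ltW.
Qed.

(** If the sequence never hits [alpha], its distance to [alpha] is eventually
    nondecreasing and positive, against convergence; once it hits [alpha] it stays there.  The
    alternative [G x = alpha] covers the zeros of the denominator of an
    iteration towards 0, where a division by zero sends the point to 0. *)
Lemma repelling_linear_convergence (R : realType) (y : nat -> R) (G : R -> R)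
    (alpha : R) :
  (forall t, y t.+1 = G (y t)) -> y @ \oo --> alpha -> G alpha = alpha ->
  (\forall x \near alpha, G x = alpha \/ `|x - alpha| <= `|G x - alpha|) ->
  linear_convergence y alpha.
Proof.
move=> yS ycvg Galpha Grep.
have [T _ yT] := ycvg _ Grep.
have [[S yS0]|yneq] := pselect (exists S, y S = alpha).
  have yconst t : (S <= t)%N -> y t = alpha.
    move=> /subnK <-; elim: (t - S)%N => // d IHd.
    by rewrite addSn yS IHd.
  exists 0, S; split=> [|t St]; first by rewrite lexx ltr01.
  by rewrite !yconst ?subrr ?normr0 ?mulr0 // leqW.
have ygrow d : `|y T - alpha| <= `|y (d + T)%N - alpha|.
  elim: d => // d IHd; rewrite addSn yS.
  have [GT|] := yT (d + T)%N (leq_addl _ _).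
    by case: yneq; exists (d + T).+1; rewrite yS.
  exact: le_trans.
have yT0 : 0 < `|y T - alpha|.
  by rewrite normr_gt0 subr_eq0; apply/eqP => yTa; apply: yneq; exists T.
have [S _ /(_ (S + T)%N (leq_addr _ _))] : \forall t \near \oo,
    `|y t - alpha| < `|y T - alpha| by exact: cvgr_distC_lt ycvg _ yT0.
by rewrite /= ltNge ygrow.
Qed.

Lemma simple_root_factor (R : realType) (f : {poly R}) (alpha : R) :
  simple_root f alpha ->
  exists2 k : {poly R}, f = k * ('X - alpha%:P) & k.[alpha] != 0.
Proof.
move=> [/eqP/factor_theorem[k ->] /eqP fder]; exists k => //.
move: fder; rewrite derivM derivXsubC !hornerE subrr.
by rewrite !(mulr0, mulr1, add0r).
Qed.

(** * Convergence at a simple root *)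

(** The reflection inequality applied to the cofactor [k] of [alpha] confines
    the multiplier to [0, 2], and simplicity excludes the value 1. *)
Lemma linear_convergence_at_positive_root (R : realType) (f u v : {poly R}) (b e : nat)
    (alpha : R) (y : nat -> R) :
  (forall z : R[i], croot f z -> 0 <= complex.Re z) ->
  u - v = (-1) ^+ b *: f ->
  u \Po (- 'X) = (-1) ^+ e *: u -> v \Po (- 'X) = - (-1) ^+ e *: v ->
  (forall t, y t.+1 = y t * (u.[y t] / v.[y t])) ->
  y @ \oo --> alpha -> 0 < alpha -> simple_root f alpha ->
  linear_convergence y alpha.
Proof.
move=> froots uvf upar vpar yS ycvg alpha0 /simple_root_factor[k fk k0].
have uvE x : u.[x] = v.[x] + (-1) ^+ b * (k.[x] * (x - alpha)).
  have /(congr1 (horner^~ x)) := uvf.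
  by rewrite fk !hornerE => <-; rewrite addrC subrK.
have kroots z : croot k z -> 0 <= complex.Re z.
  move=> kz; apply: froots.
  by rewrite /croot fk rmorphM rootM /= -/(croot k z) kz.
have kle : `|k.[alpha]| <= `|k.[- alpha]|.
  exact: ler_norm_horner_reflect kroots (ltW alpha0).
have kN0 : 0 < `|k.[- alpha]| by rewrite (lt_le_trans _ kle) // normr_gt0.
have uva : u.[alpha] = v.[alpha] by rewrite uvE subrr !mulr0 addr0.
have horner_opp (w : {poly R}) : w.[- alpha] = (w \Po (- 'X)).[alpha].
  by rewrite horner_comp hornerN hornerX.
(* Parity turns the value at [- alpha] into [v.[alpha]]: there
   [u - v = +- 2 v.[alpha]] and ['X - alpha] takes the value [- 2 * alpha]. *)
have normv : `|v.[alpha]| = alpha * `|k.[- alpha]|.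
  have E : (-1) ^+ e * (2%:R * v.[alpha]) =
      (-1) ^+ b * (k.[- alpha] * (- 2%:R * alpha)).
    have := uvE (- alpha).
    by rewrite (horner_opp u) (horner_opp v) upar vpar !hornerZ uva; lra.
  have := congr1 (fun z => `|z|) E.
  by rewrite !normrMsign !normrM normrN normr_nat (gtr0_norm alpha0); lra.
have v0 : v.[alpha] != 0 by rewrite -normr_gt0 normv mulr_gt0.
pose m x := 1 + (-1) ^+ b * x * k.[x] / v.[x].
have mcvg : m x @[x --> alpha] --> m alpha.
  apply: cvgD; first exact: cvg_cst.
  apply: cvgM; last by apply: cvgV => //; exact: continuous_horner.
  apply: cvgM; last exact: continuous_horner.
  by apply: cvgM; [exact: cvg_cst | exact: cvg_id].
have vnear : \forall x \near alpha, v.[x] != 0.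
  have cv : v.[x] @[x --> alpha] --> v.[alpha] by exact: continuous_horner.
  exact: cvgr_neq0 cv v0.
pose G x := x * (u.[x] / v.[x]).
have Gm : \forall x \near alpha, G x - alpha = m x * (x - alpha).
  apply: filterS vnear => x vx; rewrite /G /m uvE.
  by field.
have D1 : `|m alpha - 1| <= 1.
  rewrite /m addrC addKr !normrM normrV ?unitfE // normv normr_sign mul1r.
  rewrite (gtr0_norm alpha0) ler_pdivrMr ?mulr_gt0 // mul1r.
  by rewrite ler_pM2l.
have D0 : m alpha - 1 != 0.
  rewrite /m addrC addKr !mulf_neq0 ?invr_eq0 ?signr_eq0 //.
  by rewrite gt_eqF.
move: D1; rewrite ler_norml => /andP[D1 D1'].
have [m1|m1] := ltP (m alpha) 1.
  apply: (attracting_linear_convergence (G := G) (m := m)) => //.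
  by rewrite ger0_norm //; lra.
have {}m1 : 1 < m alpha by rewrite lt_def m1 andbT -subr_eq0.
apply: (repelling_linear_convergence (G := G)) => //.
  by rewrite /G uva divff // mulr1.
have mgt : \forall x \near alpha, 1 < `|m x|.
  by apply: (cvgr_norm_gt _ mcvg); rewrite gtr0_norm //; lra.
apply: filterS2 Gm mgt => x Gx mx; right.
by rewrite Gx normrM ler_peMl // ltW.
Qed.

(** An even polynomial has no linear term; only this half of the parity
    dichotomy gives information on the cofactor at 0. *)
Lemma parity_factorX (R : realType) (w : {poly R}) (e : nat) :
  w.[0] = 0 -> w \Po (- 'X) = (-1) ^+ e *: w ->
  exists2 w1 : {poly R}, w = w1 * 'X & ~~ odd e -> w1.[0] = 0.
Proof.
move=> /eqP/factor_theorem[w1]; rewrite subr0 => -> par; exists w1 => // e0.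
have /mulIf : 'X != 0 :> {poly R} by rewrite polyX_eq0.
move: par; rewrite -signr_odd (negbTE e0) scale1r comp_polyM comp_polyX.
rewrite mulrN -mulNr.
move=> par /(_ _ _ par) /(congr1 (horner^~ 0)).
by rewrite hornerN horner_comp hornerN hornerX oppr0; lra.
Qed.

(** Exactly one of [u / 'X] and [v / 'X] vanishes at 0: one by parity, not both
    because their difference there is [+- f'(0)]. *)
Lemma linear_convergence_at_zero (R : realType) (f u v : {poly R}) (b e : nat)
    (y : nat -> R) :
  u - v = (-1) ^+ b *: f ->
  u \Po (- 'X) = (-1) ^+ e *: u -> v \Po (- 'X) = - (-1) ^+ e *: v ->
  (forall t, y t.+1 = y t * (u.[y t] / v.[y t])) ->
  y @ \oo --> 0 -> simple_root f 0 ->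
  linear_convergence y 0.
Proof.
move=> uvf upar vpar yS ycvg /simple_root_factor[k]; rewrite subr0 => fk k0.
have uv0 : u.[0] = v.[0].
  have /(congr1 (horner^~ 0)) := uvf.
  by rewrite fk hornerD hornerN hornerZ hornerM hornerX !mulr0 => /subr0_eq.
have [u0 v0] : u.[0] = 0 /\ v.[0] = 0.
  have /(congr1 (horner^~ 0)) := upar; have /(congr1 (horner^~ 0)) := vpar.
  rewrite !horner_comp hornerN hornerX oppr0 !hornerZ -signr_odd.
  by case: odd; rewrite ?expr1 ?expr0; lra.
have [u1 uE u1P] := parity_factorX u0 upar.
have [|v1 vE v1P] := @parity_factorX _ v e.+1 v0.
  by rewrite exprS mulN1r.
have uv1 : u1.[0] - v1.[0] = (-1) ^+ b * k.[0].
  rewrite -hornerN -hornerD -hornerZ; congr (_.[_]).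
  have /mulIf : 'X != 0 :> {poly R} by rewrite polyX_eq0.
  by apply; rewrite mulrBl -uE -vE uvf fk scalerAl.
have uv1_neq0 : u1.[0] - v1.[0] != 0 by rewrite uv1 mulf_neq0 ?signr_eq0.
pose G x := x * (u.[x] / v.[x]).
(* At [x = 0] both sides vanish, whatever the quotients are. *)
have GE x : G x = u1.[x] / v1.[x] * x.
  rewrite /G uE vE !hornerM hornerX.
  have [->|x0] := eqVneq x 0; first by rewrite mul0r mulr0.
  by rewrite -mulf_div divff // mulr1 mulrC.
have [odd_e|even_e] := boolP (odd e).
  have v10 : v1.[0] = 0 by apply: v1P; rewrite /= odd_e.
  move: uv1_neq0; rewrite v10 subr0 => u10.
  apply: (repelling_linear_convergence (G := G)) => //; first by rewrite GE mulr0.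
  (* Half of [u1(0)] separates [|v1|], which tends to 0, from [|u1|]. *)
  have near1 : \forall x \near (0 : R), `|v1.[x]| < `|u1.[0]| / 2%:R.
    apply: (cvgr_norm_lt _ (@continuous_horner _ v1 0)).
    by rewrite v10 normr0 divr_gt0 // normr_gt0.
  have near2 : \forall x \near (0 : R), `|u1.[0]| / 2%:R < `|u1.[x]|.
    apply: (cvgr_norm_gt _ (@continuous_horner _ u1 0)).
    by have : 0 < `|u1.[0]| by [rewrite normr_gt0]; lra.
  apply: filterS2 near1 near2 => x vx ux.
  have [v1x|v1x] := eqVneq v1.[x] 0.
    by left; rewrite GE v1x invr0 mulr0 mul0r.
  right; rewrite !subr0 GE normrM ler_peMl // normrM normfV.
  by rewrite ler_pdivlMr ?normr_gt0 // mul1r ltW // (lt_trans vx).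
have u10 : u1.[0] = 0 by apply: u1P.
have v10 : v1.[0] != 0 by move: uv1_neq0; rewrite u10 sub0r oppr_eq0.
apply: (attracting_linear_convergence (G := G) (m := fun x => u1.[x] / v1.[x])) => //.
- by apply: filterE => x; rewrite !subr0 GE.
- apply: cvgM; first exact: continuous_horner.
  by apply: cvgV => //; exact: continuous_horner.
- by rewrite u10 mul0r normr0 ltr01.
Qed.

Theorem theorem3 (R : realType) (n : nat) (f : {poly R}) (a : nat -> R)
    (x0 alpha : R) (y : nat -> R)
    (f_monic : f \is monic)
    (f_deg : size f = n.+1)
    (f_roots : forall z : R[i], croot f z -> 0 <= complex.Re z)
    (f_pos_root : exists z : R[i], croot f z /\ 0 < complex.Re z)
    (a_n : a n = 1)
    (f_eq : f = alt_poly n a)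
    (x0_gt0 : 0 < x0)
    (x0_nonroot : ~~ root f x0)
    (y_def : y = mult_iter (alt_pos n a) (alt_neg n a) x0 \/
             y = mult_iter (alt_neg n a) (alt_pos n a) x0)
    (y_cvg : y @ \oo --> alpha)
    (alpha_simple : simple_root f alpha) :
  exists (rho : R) (T : nat),
    0 <= rho < 1 /\
    forall t : nat, (T <= t)%N ->
      `|y t.+1 - alpha| <= rho * `|y t - alpha|.
Proof.
rewrite -/(linear_convergence y alpha).
have alpha_ge0 : 0 <= alpha.
  apply: (f_roots alpha%:C%C); rewrite /croot /root horner_map /=.
  by case: alpha_simple => -> _.
(* The sign [b] and the parity [e] absorb the exchange of [p] and [q], so
   that both directions of the iteration have the same form. *)
have [b [e [u [v [uvf upar vpar yS]]]]] : exists b e u v,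
    [/\ u - v = (-1) ^+ b *: f, u \Po (- 'X) = (-1) ^+ e *: u,
        v \Po (- 'X) = - (-1) ^+ e *: v &
        forall t, y t.+1 = y t * (u.[y t] / v.[y t])].
  case: y_def => ->.
    exists 0%N, n, (alt_pos n a), (alt_neg n a).
    split=> //; [|exact: alt_pos_comp_oppX|exact: alt_neg_comp_oppX].
    by rewrite scale1r f_eq alt_polyE.
  exists 1%N, n.+1, (alt_neg n a), (alt_pos n a).
  split=> //; first by rewrite expr1 scaleN1r f_eq alt_polyE opprB.
    by rewrite exprS mulN1r alt_neg_comp_oppX.
  by rewrite exprS mulN1r opprK alt_pos_comp_oppX.
have [alpha0|alpha_gt0] := eqVneq alpha 0.
  rewrite alpha0 in y_cvg alpha_simple *.
  exact: linear_convergence_at_zero uvf upar vpar yS y_cvg alpha_simple.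
apply: linear_convergence_at_positive_root f_roots uvf upar vpar yS y_cvg _ alpha_simple.
by rewrite lt_def alpha_gt0.
Qed.
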